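(* There is a polynomial-time algorithm which, given any hypergraph $\mathcal{H}=(X,\mathcal{E})$ with $m$ edges, outputs a C-coloring $\varphi$ of $\mathcal{H}$ whose decrement $|X|-|\varphi(X)|$ is at most $(2+2\ln(2m))\cdot \mathrm{dec}(\mathcal{H})$.
   Context: A hypergraph $\mathcal{H}=(X,\mathcal{E})$ has a finite vertex set $X$, $|X|=n$, and a family $\mathcal{E}$ of $m$ edges, each a subset of $X$ with at least 2 vertices. A C-coloring of $\mathcal{H}$ is a map $\varphi:X\to\mathbb{N}$ such that every edge contains two distinct vertices of the same color. The upper chromatic number $\overline{\chi}(\mathcal{H})$ is the maximum number of colors $|\varphi(X)|$ over all C-colorings $\varphi$, and the decrement is $\mathrm{dec}(\mathcal{H})=n-\overline{\chi}(\mathcal{H})$. $\ln$ is the natural logarithm. *)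

(* Defs.v *)
From Stdlib Require Import Reals.
From mathcomp Require Import all_boot.

Set Implicit Arguments.
Unset Strict Implicit.
Unset Printing Implicit Defensive.

(* A hypergraph on vertex set X = 'I_n is a family (sequence, repetitions
   allowed) E of edges, each a subset of 'I_n with at least 2 vertices. *)

Definition edges_ok (n : nat) (E : seq {set 'I_n}) : bool :=
  all (fun e : {set 'I_n} => 1 < #|e|) E.

Definition is_Ccoloring (n : nat) (E : seq {set 'I_n}) (T : eqType)
  (phi : 'I_n -> T) : bool :=
  all (fun e : {set 'I_n} => [exists x in e, exists y in e, (x != y) && (phi x == phi y)]) E.

Definition num_colors (n : nat) (T : eqType) (phi : 'I_n -> T) : nat :=
  size (undup [seq phi i | i <- enum 'I_n]).

(* upper chromatic number: max number of colors of a C-coloring.  Colors may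
   be taken in 'I_n without loss of generality (at most n colors are used). *)
Definition upper_chi (n : nat) (E : seq {set 'I_n}) : nat :=
  \max_(phi : {ffun 'I_n -> 'I_n} | is_Ccoloring E phi) num_colors phi.

Definition dec (n : nat) (E : seq {set 'I_n}) : nat := n - upper_chi E.

Definition sym := 'I_3.
Definition s0 : sym := @Ordinal 3 0 isT.
Definition s1 : sym := @Ordinal 3 1 isT.
Definition ssep : sym := @Ordinal 3 2 isT.

Inductive move := MoveL | MoveR | Stay.

Record TM := {
  tm_state : finType;
  tm_tape : finType;
  tm_blank : tm_tape;
  tm_in : sym -> tm_tape;
  tm_in_inj : injective tm_in;
  tm_in_nonblank : forall a, tm_in a != tm_blank;
  tm_start : tm_state;
  tm_halting : tm_state -> bool;
  tm_delta : tm_state -> tm_tape -> tm_state * tm_tape * move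
}.

Arguments tm_blank : clear implicits.
Arguments tm_in : clear implicits.
Arguments tm_start : clear implicits.
Arguments tm_halting : clear implicits.
Arguments tm_delta : clear implicits.

(* configuration: state, left part (nearest cell first), head cell, right part *)
Definition config (M : TM) : Type :=
  (tm_state M * seq (tm_tape M) * tm_tape M * seq (tm_tape M))%type.

Definition tm_step (M : TM) (c : config M) : config M :=
  let: (q, l, h, r) := c in
  if tm_halting M q then c else
  let: (q', w, mv) := tm_delta M q h in
  match mv with
  | Stay => (q', l, w, r)
  | MoveL => match l with
             | [::] => (q', [::], tm_blank M, w :: r)
             | x :: l' => (q', l', x, w :: r)
             end
  | MoveR => match r with
             | [::] => (q', w :: l, tm_blank M, [::])
             | x :: r' => (q', w :: l, x, r')
             end
  end.

Definition tm_init (M : TM) (s : seq sym) : config M :=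
  match s with
  | [::] => (tm_start M, [::], tm_blank M, [::])
  | a :: s' => (tm_start M, [::], tm_in M a, map (tm_in M) s')
  end.

Definition halts_with (M : TM) (s : seq sym) (t : nat) (o : seq sym) : Prop :=
  let: (q, l, h, r) := iter t (tm_step (M:=M)) (tm_init M s) in
  tm_halting M q /\ exists j, h :: r = map (tm_in M) o ++ nseq j (tm_blank M).

Definition enc_hg (n : nat) (E : seq {set 'I_n}) : seq sym :=
  nseq n s1 ++ ssep ::
  flatten [seq [seq (if i \in e then s1 else s0) | i <- enum 'I_n] ++ [:: ssep]
          | e : {set 'I_n} <- E].

Definition enc_col (cols : seq nat) : seq sym :=
  flatten [seq nseq c s1 ++ [:: ssep] | c <- cols].

(* Main.v *)
Require Import Defs.
From Stdlib Require Import Reals Lra.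
From HB Require Import structures.
From mathcomp Require Import all_boot zify.

(* Let S be a set meeting every edge in at least two vertices.  Coloring S with
   one color and all other vertices with distinct colors is a C-coloring of
   decrement |S| - 1.  Conversely, in an optimal C-coloring the vertices whose
   color is repeated form such a set, of size k <= 2 dec.  The algorithm builds
   S greedily, always picking a vertex lying in the most edges hit at most once.
   Each pick removes a fraction at least 1/k of the remaining demand, which is
   2m at first, so 1 <= 2m (1 - 1/k)^(|S| - 1), that is |S| - 1 <= k ln (2m).

   The Turing machine sweeps its input again and again as a Mealy automaton.
   The input is an incidence matrix below a header row 1^n; two columns are
   marked in all rows at once, and one sweep moves or updates a mark in every
   row.  The gains of the two marked vertices are compared by cancelling, one
   sweep at a time, an edge counting only for the first against one counting
   only for the second. *)

Set Implicit Arguments.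
Unset Strict Implicit.
Unset Printing Implicit Defensive.

(** * Transducers and their simulation by Turing machines *)

Definition reach (C : Type) (f : C -> C) (k : nat) (x y : C) : Prop :=
  exists2 t, t <= k & iter t f x = y.

Lemma reach0 (C : Type) (f : C -> C) k x : reach f k x x.
Proof. by exists 0. Qed.

Lemma reach1 (C : Type) (f : C -> C) x : reach f 1 x (f x).
Proof. by exists 1. Qed.

Lemma reach_trans (C : Type) (f : C -> C) a b x y z :
  reach f a x y -> reach f b y z -> reach f (a + b) x z.
Proof.
move=> [s les <-] [t let_ <-]; exists (t + s); first by rewrite addnC leq_add.
by rewrite iterD.
Qed.

Lemma reach_leq (C : Type) (f : C -> C) a b x y :
  a <= b -> reach f a x y -> reach f b x y.
Proof.
by move=> le_ab [t le_ta <-]; exists t => //; apply: leq_trans le_ab.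
Qed.

Fixpoint sweep (S A : Type) (f : S -> A -> S * A) (s : S) (w : seq A) :
    S * seq A :=
  if w is x :: w' then
    let: (s', w'') := sweep f (f s x).1 w' in (s', (f s x).2 :: w'')
  else (s, [::]).

Lemma sweep_cat (S A : Type) (f : S -> A -> S * A) s w1 w2 :
  sweep f s (w1 ++ w2) =
  ((sweep f (sweep f s w1).1 w2).1,
   (sweep f s w1).2 ++ (sweep f (sweep f s w1).1 w2).2).
Proof.
elim: w1 s => [|x w1 IH] s /=; first by case: (sweep f s w2).
by rewrite IH; case: (sweep f (f s x).1 w1).
Qed.

Lemma size_sweep (S A : Type) (f : S -> A -> S * A) s w :
  size (sweep f s w).2 = size w.
Proof.
elim: w s => //= x w IH s.
by rewrite -(IH (f s x).1); case: (sweep f (f s x).1 w).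
Qed.

(* A transducer sweeps its work tape from left to right again and again; at the
   end of each sweep it may append one symbol to a write-only output. *)
Record transducer := Transducer {
  tr_state : finType;
  tr_cell : finType;
  tr_load : sym -> tr_cell;
  tr_start : tr_state;
  tr_step : tr_state -> tr_cell -> tr_state * tr_cell;
  tr_emit : tr_state -> option sym;
  tr_next : tr_state -> tr_state;
  tr_stop : tr_state -> bool
}.

Definition tr_config (A : transducer) : Type :=
  (tr_state A * seq (tr_cell A) * seq sym)%type.

Definition round (A : transducer) (c : tr_config A) : tr_config A :=
  let: (s, w, o) := c in
  if tr_stop s then c else
  let: (s', w') := sweep (@tr_step A) s w in
  (tr_next s', w', if tr_emit s' is Some a then rcons o a else o).

Lemma iter_round_size (A : transducer) t s w o :
  let: (_, w', o') := iter t (@round A) (s, w, o) in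
  size w' = size w /\ size o' <= size o + t.
Proof.
elim: t => [|t IH] /=; first by rewrite addn0.
case: (iter t _ _) IH => [[s' w'] o'] [Ew lo] /=.
case: ifP => _; first by split=> //; lia.
move: (size_sweep (@tr_step A) s' w'); case: (sweep _ s' w') => s2 w2 /= Ew2.
split; first by rewrite Ew2.
by case: (tr_emit s2) => [a|]; rewrite ?size_rcons; lia.
Qed.

(** [None] is the blank and also the left end marker; [inl] holds input and output symbols, [inr]
    work cells. The output grows to the right of the work cells. *)
Definition sim_cell (A : transducer) : finType := option (sym + tr_cell A)%type.

Definition sim_state (A : transducer) : finType :=
  ((tr_state A + tr_state A) + option bool)%type.

Notation Fwd s := (inl (inl s)).
Notation Back s := (inl (inr s)).
Notation Loading := (inr None).
Notation Closing := (inr (Some false)).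
Notation Done := (inr (Some true)).

Definition sim_delta (A : transducer) (q : sim_state A) (h : sim_cell A) :
    sim_state A * sim_cell A * move :=
  match q, h with
  | Loading, Some (inl a) => (Loading, Some (inr (tr_load A a)), MoveR)
  | Loading, _ => (Back (tr_start A), None, MoveL)
  | Back s, Some _ => (Back s, h, MoveL)
  | Back s, None => (if tr_stop s then Closing else Fwd s, None, MoveR)
  | Fwd s, Some (inr x) =>
      (Fwd (tr_step s x).1, Some (inr (tr_step s x).2), MoveR)
  | Fwd s, Some (inl a) => (Fwd s, h, MoveR)
  | Fwd s, None => (Back (tr_next s), omap inl (tr_emit s), MoveL)
  | Closing, Some (inr x) => (Closing, h, MoveR)
  | Closing, _ => (Done, h, Stay)
  | Done, _ => (Done, h, Stay)
  end.

Definition sim_in (A : transducer) (a : sym) : sim_cell A := Some (inl a).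

Lemma sim_in_inj (A : transducer) : injective (@sim_in A).
Proof. by move=> a b []. Qed.

Lemma sim_in_nonblank (A : transducer) a : @sim_in A a != None.
Proof. by []. Qed.

Definition sim (A : transducer) : TM :=
  {| tm_state := sim_state A; tm_tape := sim_cell A; tm_blank := None;
     tm_in := @sim_in A; tm_in_inj := @sim_in_inj A;
     tm_in_nonblank := @sim_in_nonblank A; tm_start := Loading;
     tm_halting := fun q => if q is Done then true else false;
     tm_delta := @sim_delta A |}.

Notation step A := (@tm_step (sim A)).

Definition at_cells (A : transducer) (q : sim_state A)
    (l r : seq (sim_cell A)) : config (sim A) := (q, l, head None r, behead r).

Lemma step_right (A : transducer) (q q' : sim_state A) h w l r :
  tm_halting (sim A) q = false -> sim_delta q h = (q', w, MoveR) ->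
  step A (at_cells q l (h :: r)) = at_cells q' (w :: l) r.
Proof. by move=> Hq Hd; rewrite /at_cells /tm_step Hq /= Hd; case: r. Qed.

Lemma load_pass (A : transducer) (s : seq sym) l :
  reach (step A) (size s) (at_cells Loading l (map (@sim_in A) s))
    (at_cells Loading (rev [seq Some (inr (tr_load A a)) | a <- s] ++ l) [::]).
Proof.
elim: s l => [|a s IH] l; first exact: reach0.
apply: (@reach_trans _ _ 1) (reach1 _ _) _.
rewrite [map _ (a :: s)]/= [X in reach _ _ X _]/=.
have := IH (Some (inr (tr_load A a)) :: l).
rewrite /at_cells /= rev_cons cat_rcons.
by case: (map _ s).
Qed.

Lemma fwd_pass (A : transducer) (w : seq (tr_cell A)) s l r :
  reach (step A) (size w)
    (at_cells (Fwd s) l ([seq Some (inr x) | x <- w] ++ r))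
    (at_cells (Fwd (sweep (@tr_step A) s w).1)
       (rev [seq Some (inr x) | x <- (sweep (@tr_step A) s w).2] ++ l) r).
Proof.
elim: w s l => [|x w IH] s l; first exact: reach0.
apply: (@reach_trans _ _ 1) (reach1 _ _) _.
rewrite [X in reach _ _ X _]/=.
have := IH (tr_step s x).1 (Some (inr (tr_step s x).2) :: l).
rewrite /at_cells /=; case: (sweep _ _ w) => s' w' /=.
rewrite rev_cons cat_rcons; by case: (_ ++ r).
Qed.

Lemma skip_output (A : transducer) (o : seq sym) s l r :
  reach (step A) (size o)
    (at_cells (Fwd s) l ([seq Some (inl a) | a <- o] ++ r))
    (at_cells (Fwd s) (rev [seq Some (inl a) | a <- o] ++ l) r).
Proof.
elim: o l => [|a o IH] l; first exact: reach0.
apply: (@reach_trans _ _ 1) (reach1 _ _) _.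
rewrite [X in reach _ _ X _]/=.
have := IH (Some (inl a) :: l).
by rewrite /at_cells /= rev_cons cat_rcons; case: (_ ++ r).
Qed.

(** With [i = 0] no marker exists yet: moving left off the tape creates a blank, which becomes the
    marker. With [i = 1] the head stops on the existing one. *)
Lemma back_pass (A : transducer) (u : seq (sym + tr_cell A)) s x i r :
  i <= 1 ->
  reach (step A) (size u).+1
    (at_cells (Back s) (map Some u ++ nseq i None) (Some x :: r))
    (at_cells (Back s) [::] (None :: rev (map Some u) ++ Some x :: r)).
Proof.
move=> le_i1; elim: u x r => [|y u IH] x r.
  have := reach1 (step A) (at_cells (Back s) (nseq i None) (Some x :: r)).
  by case: i le_i1 => [|[|i]].
rewrite -[(size _).+1]add1n.
apply: (@reach_trans _ _ 1) (reach1 _ _) _.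
by have := IH y (Some x :: r); rewrite /at_cells /= rev_cons cat_rcons.
Qed.

Lemma close_pass (A : transducer) (w : seq (tr_cell A)) l r :
  reach (step A) (size w)
    (at_cells Closing l ([seq Some (inr x) | x <- w] ++ r))
    (at_cells Closing (rev [seq Some (inr x) | x <- w] ++ l) r).
Proof.
elim: w l => [|x w IH] l; first exact: reach0.
apply: (@reach_trans _ _ 1) (reach1 _ _) _.
rewrite [X in reach _ _ X _]/=.
have := IH (Some (inr x) :: l).
by rewrite /at_cells /= rev_cons cat_rcons; case: (_ ++ r).
Qed.

Definition home (A : transducer) (c : tr_config A) (j : nat) : config (sim A) :=
  let: (s, w, o) := c in
  at_cells (Back s) [::]
    (None :: [seq Some (inr x) | x <- w] ++ [seq Some (inl a) | a <- o] ++
       nseq j None).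

Lemma sim_load (A : transducer) (a : sym) (s : seq sym) :
  reach (step A) ((size s).+1.*2 + 2) (tm_init (sim A) (a :: s))
    (home (tr_start A, map (tr_load A) (a :: s), [::]) 1).
Proof.
have -> : (size s).+1.*2 + 2 = (size s).+1 + (1 + ((size s).+1 + 1)).
  by rewrite -addnn; lia.
apply: reach_trans; first exact: (load_pass (a :: s) [::]).
apply: reach_trans; first exact: reach1.
elim/last_ind: s => [|s b _].
  by apply: (@reach_leq _ _ 1) => //; exact: reach1.
set u := [seq (inr (tr_load A c) : sym + tr_cell A) | c <- a :: s].
have Hu : [seq Some (inr (tr_load A c)) | c <- a :: rcons s b] =
          rcons (map Some u) (Some (inr (tr_load A b))).
  by rewrite -rcons_cons map_rcons /u -map_comp.
rewrite Hu cats0 rev_rcons.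
have := @back_pass A (rev u) (tr_start A) (inr (tr_load A b)) 0 [:: None] isT.
rewrite cats0 !map_rev revK size_rev size_map /= => H.
move: H; rewrite -!map_comp map_rcons cat_rcons => H.
by apply: reach_leq H; rewrite size_rcons addn1.
Qed.

Lemma sim_round (A : transducer) (c : tr_config A) j :
  0 < size c.1.2 ->
  exists j', reach (step A) (2 * (size c.1.2 + size c.2) + 3)
    (home c j) (home (round c) j').
Proof.
case: c => [[s w] o] /= w_gt0.
case Hs: (tr_stop s); first by exists j; exact: reach0.
have Hw : size (sweep (@tr_step A) s w).2 = size w by exact: size_sweep.
move: (fwd_pass w s [:: None] ([seq Some (inl a) | a <- o] ++ nseq j None)).
case: (sweep _ s w) Hw => s1 w1 /= Hw Hf.
(* An emitted symbol fills the first trailing blank, if any; otherwise that blank stays on the tape,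
   even if the head has just created it. *)
exists (if tr_emit s1 is Some _ then j.-1 else maxn j 1).
have -> : 2 * (size w + size o) + 3 =
  1 + (size w + (size o + (1 + (size w + size o + 1)))) by lia.
apply: reach_trans (reach1 _ _) _.
rewrite (@step_right _ _ (Fwd s) _ None) ?Hs /= ?Hs //.
apply: reach_trans; first exact: Hf.
apply: reach_trans; first exact: skip_output.
apply: reach_trans (reach1 _ _) _.
set u := map inr w1 ++ map inl o.
have Eu : rev [seq Some (inl a) | a <- o] ++
    rev [seq Some (inr x) | x <- w1] ++ [:: None] =
    map Some (rev u) ++ nseq 1 None.
  by rewrite catA -rev_cat map_rev /u map_cat -!map_comp.
rewrite Eu.
have u_gt0 : 0 < size u by rewrite /u size_cat !size_map; lia.
have su : size u = size w + size o by rewrite /u size_cat !size_map Hw.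
have Er : [seq Some (inr x) | x <- w1] ++ [seq Some (inl a) | a <- o] =
    map Some u.
  by rewrite /u map_cat -!map_comp.
have Hb : head None (nseq j (None : sim_cell A)) = None by case: (j).
have {}Hb :
    step A (at_cells (Fwd s1) (map Some (rev u) ++ nseq 1 None)
      (nseq j None)) =
    at_cells (Back (tr_next s1)) (behead (map Some (rev u)) ++ nseq 1 None)
      (head None (map Some (rev u)) :: omap inl (tr_emit s1) ::
         nseq j.-1 None).
  rewrite /at_cells /= Hb /=.
  have : 0 < size (map Some (rev u)) by rewrite size_map size_rev.
  by case: (map Some (rev u)) => //= x v _; case: (j).
rewrite Hb.
elim/last_ind: u {Eu Hb} u_gt0 su Er => // u y _ _ su Er.
rewrite rev_rcons /=.
have H := @back_pass A (rev u) (tr_next s1) y 1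
  (omap inl (tr_emit s1) :: nseq j.-1 None) isT.
have le1 : (size (rev u)).+1 <= size w + size o + 1.
  by rewrite size_rev -su size_rcons; lia.
apply: reach_leq le1 _.
move: H; rewrite -map_rev revK.
set X := at_cells _ [::] _; set Y := at_cells _ [::] _.
suff -> : Y = X by [].
rewrite {}/X {}/Y /at_cells /=; congr (_, _).
have Es (r : seq (sim_cell A)) :
    map Some u ++ Some y :: r = map Some (rcons u y) ++ r.
  by rewrite map_rcons cat_rcons.
rewrite Es -Er; case: (tr_emit s1) => [a|] /=.
  by rewrite map_rcons cat_rcons catA.
rewrite -catA; congr (_ ++ (_ ++ _)); by case: (j) => //= k; rewrite maxnC.
Qed.

Lemma sim_rounds (A : transducer) (c : tr_config A) t j :
  0 < size c.1.2 ->
  exists j', reach (step A) (t * (2 * (size c.1.2 + size c.2 + t) + 3))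
    (home c j) (home (iter t (@round A) c) j').
Proof.
move=> w_gt0; elim: t => [|t [j1 IH]]; first by exists j; exact: reach0.
have [Ew le_o] : size (iter t (@round A) c).1.2 = size c.1.2 /\
   size (iter t (@round A) c).2 <= size c.2 + t.
  case: c {w_gt0 IH} => [[s w] o].
  by have := iter_round_size t s w o; case: (iter t _ _) => [[]].
have [|j2 H2] := @sim_round A (iter t (@round A) c) j1; first by rewrite Ew.
exists j2; apply: reach_leq (reach_trans IH H2).
rewrite Ew; nia.
Qed.

(** The work cells remain to the left of the head, where [halts_with] does not look. *)
Lemma sim_close (A : transducer) s w o j :
  tr_stop s ->
  exists2 c, reach (step A) (size w + 2) (home (s, w, o) j) c
    & tm_halting (sim A) c.1.1.1 /\
      exists j', c.1.2 :: c.2 =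
        map (tm_in (sim A)) o ++ nseq j' (tm_blank (sim A)).
Proof.
move=> Hs.
pose l : seq (sim_cell A) := rev [seq Some (inr x) | x <- w] ++ [:: None].
pose r : seq (sim_cell A) := [seq Some (inl a) | a <- o] ++ nseq j None.
exists (at_cells (Done : sim_state A) l r).
  have -> : size w + 2 = 1 + (size w + 1) by lia.
  apply: reach_trans (reach1 _ _) _.
  rewrite (@step_right _ _ Closing _ None) ?Hs /= ?Hs //.
  apply: reach_trans; first exact: close_pass.
  rewrite -/l -/r.
  suff <- : step A (at_cells Closing l r) = at_cells Done l r by exact: reach1.
  by rewrite /r /at_cells; case: (o) => [|a o'] //=; case: (j).
split=> //; rewrite /at_cells /= /r {r}.
case: o => [|a o'] /=; last by exists j.
by case: j => [|j]; [exists 1 | exists j.+1].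
Qed.

(** Each of the [K] rounds crosses the work tape and an output of length at most [K] once each way;
    loading and closing account for the [+ 2]. *)
Lemma transducer_sim (A : transducer) (x o : seq sym) (K : nat) s w :
  0 < size x ->
  reach (@round A) K (tr_start A, map (tr_load A) x, [::]) (s, w, o) ->
  tr_stop s ->
  exists2 t, t <= (K + 2) * (2 * (size x + K) + 3) & halts_with (sim A) x t o.
Proof.
case: x => // a x _ [t le_tK Et] Hs.
have H1 := sim_load A a x.
have [|j H2] := @sim_rounds A (tr_start A, map (tr_load A) (a :: x), [::]) t 1.
  by [].
have Ew : size w = size (a :: x).
  have := iter_round_size t (tr_start A) (map (tr_load A) (a :: x)) [::].
  by rewrite Et size_map => -[].
rewrite Et in H2.
have [c H3 [hc [j' Ej]]] := @sim_close A s w o j Hs.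
have [t' le_t' Et'] := reach_trans (reach_trans H1 H2) H3.
exists t'; last first.
  rewrite /halts_with Et'; case: c {H3 Et'} hc Ej => [[[q l] h] r] /= hc Ej.
  by split=> //; exists j'.
apply: leq_trans le_t' _; rewrite Ew /= size_map -addnn.
move: (size x) => z; nia.
Qed.

(** * The sweeping automaton *)

(* [Cell x c b]: [x] is the matrix entry, erased once the vertex is picked, [c]
   and [b] are the marks of the current and of the best column so far.
   [Sep p q u] closes a row: [p] and [q] tell that the edge is hit at least
   once, resp. twice, by the picked vertices, and [u] that it was already
   cancelled. *)
Definition cell : finType := (bool * bool * bool + bool * bool * bool)%type.

Notation Cell x c b := (inl (x, c, b)).
Notation Sep p q u := (inr (p, q, u)).

Definition load (a : sym) : cell :=
  if a == ssep then Sep false false false else Cell (a == s1) false false.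

(* One constructor per kind of sweep:
   - [RStart (header seen)] declares the header row satisfied;
   - [RInit (row start) (unsatisfied row seen)] puts both marks on column 0;
   - [RCmp hc hb gc gb] cancels one edge counting only for the current column
     and one counting only for the best one; [hc], [hb] are the entries of the
     row in these columns, [gc], [gb] tell which kinds were found;
   - [RAdv k carry fell] moves the current mark right, after copying it to the
     best mark if [k]; [fell] tells that it left the matrix;
   - [RPick hit] picks the best vertex;
   - [ROnes header carry found x eq] moves the best mark right; in the header,
     [x] is the entry of the current column and [eq] tells that the marks agree;
   - [RNext (row start) carry] moves the current mark right and resets the best
     one to column 0. *)
Inductive reg :=
  | RStart of bool
  | RInit of bool & bool
  | RCmp of bool & bool & bool & bool
  | RAdv of bool & bool & bool
  | RPick of bool
  | ROnes of bool & bool & bool & bool & bool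
  | RNext of bool & bool
  | RHalt.

(** An injection into a finite type, from which [reg] inherits its [finType] structure; spare slots
    are padded. *)
Definition reg_code (s : reg) : 'I_8 * (bool * bool * bool * bool * bool) :=
  match s with
  | RStart a => (inord 0, (a, a, a, a, a))
  | RInit a b => (inord 1, (a, b, a, a, a))
  | RCmp a b c d => (inord 2, (a, b, c, d, a))
  | RAdv a b c => (inord 3, (a, b, c, a, a))
  | RPick a => (inord 4, (a, a, a, a, a))
  | ROnes a b c d e => (inord 5, (a, b, c, d, e))
  | RNext a b => (inord 6, (a, b, a, a, a))
  | RHalt => (inord 7, (true, true, true, true, true))
  end.

Definition reg_decode (t : 'I_8 * (bool * bool * bool * bool * bool)) : reg :=
  let: (k, (a, b, c, d, e)) := t in
  match val k with
  | 0 => RStart a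
  | 1 => RInit a b
  | 2 => RCmp a b c d
  | 3 => RAdv a b c
  | 4 => RPick a
  | 5 => ROnes a b c d e
  | 6 => RNext a b
  | _ => RHalt
  end.

Lemma reg_codeK : cancel reg_code reg_decode.
Proof. by case=> *; rewrite /= inordK. Qed.

HB.instance Definition _ := Finite.copy reg (can_type reg_codeK).

Definition greedy_step (s : reg) (a : cell) : reg * cell :=
  match s, a with
  | RStart t, Cell _ _ _ => (s, a)
  | RStart t, Sep p q u => (RStart true, Sep (p || ~~ t) (q || ~~ t) u)
  | RInit t u, Cell x _ _ => (RInit false u, Cell x t t)
  | RInit t u, Sep p q _ => (RInit true (u || ~~ q), Sep p q false)
  | RCmp hc hb gc gb, Cell x c b =>
      (RCmp (hc || c && x) (hb || b && x) gc gb, a)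
  | RCmp hc hb gc gb, Sep p q u =>
      let tc := [&& ~~ q, ~~ u, hc & ~~ hb] in
      let tb := [&& ~~ q, ~~ u, hb & ~~ hc] in
      (RCmp false false (gc || tc) (gb || tb),
       Sep p q [|| u, ~~ gc && tc | ~~ gb && tb])
  | RAdv k cy fell, Cell x c b =>
      (RAdv k c fell, Cell x cy (if k then c else b))
  | RAdv k cy fell, Sep p q _ => (RAdv k false (fell || cy), Sep p q false)
  | RPick h, Cell x c b => (RPick (h || b && x), Cell (x && ~~ b) c b)
  | RPick h, Sep p q u =>
      (RPick false, if h then Sep true p u else Sep p q u)
  | ROnes hd cy fd x e, Cell y c b =>
      (ROnes hd b (fd || hd && c) (if hd && c then y else x)
         (if hd && c then b else e), Cell y c cy)
  | ROnes _ _ fd x e, Sep _ _ _ => (ROnes false false fd x e, a)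
  | RNext t cy, Cell y c _ => (RNext false c, Cell y cy t)
  | RNext t cy, Sep _ _ _ => (RNext true false, a)
  | RHalt, _ => (RHalt, a)
  end.

Definition cmp0 := RCmp false false false false.
Definition ones0 := ROnes true false false false false.

(** An [RCmp] sweep that misses one of the two kinds ends the comparison; ties keep the best mark.
    [ROnes] repeats until the best mark, started at column 0, meets the current one. *)
Definition greedy_next (s : reg) : reg :=
  match s with
  | RStart _ => RInit true false
  | RInit _ u => if u then cmp0 else ones0
  | RCmp _ _ gc gb => if gc && gb then cmp0 else RAdv (gc && ~~ gb) false false
  | RAdv _ _ fell => if fell then RPick false else cmp0
  | RPick _ => RInit true false
  | ROnes _ _ fd x e =>
      if ~~ fd then RHalt else if x && ~~ e then ones0 else RNext true false
  | RNext _ _ => ones0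
  | RHalt => RHalt
  end.

Definition greedy_emit (s : reg) : option sym :=
  match s with
  | ROnes _ _ fd x e => if fd && x then Some s1 else None
  | RNext _ _ => Some ssep
  | _ => None
  end.

Definition greedy_tr : transducer :=
  {| tr_state := reg; tr_cell := cell; tr_load := load;
     tr_start := RStart false; tr_step := greedy_step;
     tr_emit := greedy_emit; tr_next := greedy_next;
     tr_stop := fun s => if s is RHalt then true else false |}.

(** * The matrix on the tape and its sweeps, row by row *)

Definition row (n : nat) : Type := ({set 'I_n} * bool * bool * bool)%type.

(** Mark positions are natural numbers: a position of at least [n] stands for an absent mark. *)
Definition block (n c b : nat) (r : row n) : seq cell :=
  let: (x, p, q, u) := r in
  [seq Cell (i \in x) (i == c :> nat) (i == b :> nat) | i <- enum 'I_n] ++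
  [:: Sep p q u].

Definition layout (n c b : nat) (rs : seq (row n)) : seq cell :=
  flatten [seq block c b r | r <- rs].

Lemma layout_cons (n c b : nat) (r : row n) rs :
  layout c b (r :: rs) = block c b r ++ layout c b rs.
Proof. by []. Qed.

(** [st i] is the state before column [i]; giving it in closed form reduces the sweep of a row to
    one identity per column. *)
Lemma sweep_enum (n : nat) (T A : Type) (f : T -> A -> T * A) (st : nat -> T)
    (g g' : 'I_n -> A) :
  (forall i : 'I_n, f (st i) (g i) = (st i.+1, g' i)) ->
  sweep f (st 0) [seq g i | i <- enum 'I_n] =
  (st n, [seq g' i | i <- enum 'I_n]).
Proof.
move=> Hf; have Hs : map val (enum 'I_n) = iota 0 (size (enum 'I_n)).
  by rewrite val_enum_ord size_enum_ord.
have -> : st n = st (0 + size (enum 'I_n)) by rewrite size_enum_ord.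
elim: (enum 'I_n) 0 Hs => [|i s IH] k /=; first by rewrite addn0.
by move=> [Ek Hs]; rewrite -Ek Hf /= Ek IH // addSnnS.
Qed.

Lemma sweep_block (n c b c' b' : nat) (st : nat -> reg) (x x' : {set 'I_n})
    p q u p' q' u' s' :
  (forall i : 'I_n,
     greedy_step (st i) (Cell (i \in x) (i == c :> nat) (i == b :> nat)) =
     (st i.+1, Cell (i \in x') (i == c' :> nat) (i == b' :> nat))) ->
  greedy_step (st n) (Sep p q u) = (s', Sep p' q' u') ->
  sweep greedy_step (st 0) (block c b (x, p, q, u)) =
  (s', block c' b' (x', p', q', u')).
Proof.
move=> Hc Hs; rewrite /block sweep_cat (sweep_enum (st := st) Hc).
by rewrite [sweep _ _ [:: _]]/= Hs.
Qed.

(** [F] is the induced automaton on whole rows, and [emb] gives the registers considered at row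
    boundaries. *)
Lemma sweep_layout (n c b c' b' : nat) (T : Type) (emb : T -> reg)
    (F : T -> row n -> T * row n) :
  (forall t r, sweep greedy_step (emb t) (block c b r) =
     (emb (F t r).1, block c' b' (F t r).2)) ->
  forall rs t,
    sweep greedy_step (emb t) (layout c b rs) =
    (emb (sweep F t rs).1, layout c' b' (sweep F t rs).2).
Proof.
move=> HF; elim=> [|r rs IH] t //.
rewrite !layout_cons sweep_cat HF IH /=.
by case: (sweep F _ rs).
Qed.

Lemma sweep_fixed (T A : Type) (f : T -> A -> T * A) s (g : A -> A) w :
  (forall x, f s x = (s, g x)) -> sweep f s w = (s, map g w).
Proof. by move=> Hf; elim: w => //= x w IH; rewrite Hf IH. Qed.

Definition unflag (n : nat) (r : row n) : row n := (r.1, false).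

Definition settle (n : nat) (r : row n) : row n :=
  let: (x, p, q, u) := r in (x, true, true, u).

Lemma round_start (n c b : nat) (r : row n) rs :
  round (A := greedy_tr) (RStart false, layout c b (r :: rs), [::]) =
  (RInit true false, layout c b (settle r :: rs), [::]).
Proof.
rewrite /round /= -/(layout c b (r :: rs)).
pose F (t : bool) (r : row n) : bool * row n :=
  (true, if t then r else settle r).
rewrite (@sweep_layout n c b c b bool RStart F).
  rewrite /= (_ : sweep F true rs = (true, rs)) //.
  by rewrite (sweep_fixed (g := id)) ?map_id.
move=> t [[[x p] q] u].
have -> : (F t (x, p, q, u)).2 = (x, p || ~~ t, q || ~~ t, u).
  by case: t; rewrite /= ?orbT ?orbF.
exact: (sweep_block (st := fun=> RStart t)).
Qed.

Definition unsat (n : nat) (r : row n) : bool := ~~ r.1.2.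

Lemma round_init (n c b : nat) (rs : seq (row n)) o :
  round (A := greedy_tr) (RInit true false, layout c b rs, o) =
  (if has (@unsat n) rs then cmp0 else ones0,
   layout 0 0 [seq unflag r | r <- rs], o).
Proof.
rewrite /round /=.
pose F (t : bool) (r : row n) := (t || unsat r, unflag r).
rewrite (@sweep_layout n c b 0 0 bool (RInit true) F); last first.
  move=> t [[[x p] q] u].
  apply: (sweep_block (st := fun j => RInit (j == 0) t)) => //=.
have -> t : sweep F t rs = (t || has (@unsat n) rs, map (@unflag n) rs).
  elim: rs t => [|r rs IH] t /=; first by rewrite orbF.
  by rewrite IH orbA.
by [].
Qed.

(** * Comparing the gains of two columns *)

Definition only (n : nat) (c b : 'I_n) (r : row n) : bool :=
  let: (x, p, q, u) := r in [&& ~~ q, ~~ u, c \in x & b \notin x].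

Definition cmp_row (n : nat) (c b : 'I_n) (t : bool * bool) (r : row n) :
    (bool * bool) * row n :=
  ((t.1 || only c b r, t.2 || only b c r),
   (r.1, [|| r.2, ~~ t.1 && only c b r | ~~ t.2 && only b c r])).

(** Invariant of a register that remembers the entry of a marked column: before column [i] it holds
    [(c < i) && (c \in x)]. *)
Lemma seen_step (n : nat) (c i : 'I_n) (x : {set 'I_n}) :
  (c < i) && (c \in x) || (i == c :> nat) && (i \in x) =
  (c < i.+1) && (c \in x).
Proof.
rewrite ltnS (leq_eqVlt c) [c == i :> nat]eq_sym.
by case: (eqVneq (i : nat) c) => [/ord_inj ->|_]; rewrite ?ltnn ?orbF.
Qed.

Lemma round_cmp (n : nat) (c b : 'I_n) (rs : seq (row n)) o :
  round (A := greedy_tr) (cmp0, layout c b rs, o) =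
  let: (t, rs') := sweep (cmp_row c b) (false, false) rs in
  (if t.1 && t.2 then cmp0 else RAdv (t.1 && ~~ t.2) false false,
   layout c b rs', o).
Proof.
rewrite /round /=.
have -> : cmp0 = (fun t => RCmp false false t.1 t.2) (false, false) by [].
rewrite (sweep_layout (c' := c) (b' := b)
  (emb := fun t => RCmp false false t.1 t.2) (F := cmp_row c b)).
  by case: (sweep _ _ rs).
move=> [gc gb] [[[x p] q] u].
apply: (sweep_block (st := fun j =>
  RCmp ((c < j) && (c \in x)) ((b < j) && (b \in x)) gc gb)).
  by move=> i /=; rewrite !seen_step.
by rewrite /= !ltn_ord.
Qed.

Definition row_gain (n : nat) (v : 'I_n) (r : row n) : bool :=
  unsat r && (v \in r.1.1.1).

(** The first row found of each kind is cancelled; truncated subtraction covers a kind with no row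
    left. *)
Lemma sweep_cmp (n : nat) (c b : 'I_n) (rs : seq (row n)) (gc gb : bool) :
  let: (t, rs') := sweep (cmp_row c b) (gc, gb) rs in
  [/\ t = (gc || has (only c b) rs, gb || has (only b c) rs),
      map (@unflag n) rs' = map (@unflag n) rs,
      count (only c b) rs' = count (only c b) rs - ~~ gc
    & count (only b c) rs' = count (only b c) rs - ~~ gb].
Proof.
elim: rs gc gb => [|r rs IH] gc gb /=; first by rewrite !orbF.
case: (sweep _ _ rs) (IH (gc || only c b r) (gb || only b c r)).
move=> t rs' [-> E1 E2 E3]; rewrite !orbA; split=> //=.
- by rewrite E1.
- rewrite {}E2 {E3} /=; case: r => [[[x p] q] u] /=.
  by case: q u gc gb (c \in x) (b \in x) => [] [] [] [] [] [] /=; lia.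
- rewrite {}E3 {E2} /=; case: r => [[[x p] q] u] /=.
  by case: q u gc gb (c \in x) (b \in x) => [] [] [] [] [] [] /=; lia.
Qed.

(** Every sweep but the last lowers both counts by one, which preserves their order. The last finds
    only the more frequent kind, or none if the counts agree. *)
Lemma reach_cmp (n : nat) (c b : 'I_n) (rs : seq (row n)) o :
  exists2 rs', map (@unflag n) rs' = map (@unflag n) rs &
  reach (@round greedy_tr) (count (only c b) rs).+1 (cmp0, layout c b rs, o)
    (RAdv (count (only b c) rs < count (only c b) rs) false false,
     layout c b rs', o).
Proof.
move Ek : (count (only c b) rs) => k; elim: k rs Ek => [|k IH] rs Ek.
  have := round_cmp c b rs o; have := sweep_cmp c b rs false false.
  case: (sweep _ _ rs) => t rs' [-> E1 _ _] Er; exists rs' => //.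
  have := reach1 (@round greedy_tr) (cmp0, layout c b rs, o).
  by rewrite Er /= has_count Ek.
have := round_cmp c b rs o; have := sweep_cmp c b rs false false.
case: (sweep _ _ rs) => t rs1 [-> E1 E2 E3] Er.
have := reach1 (@round greedy_tr) (cmp0, layout c b rs, o).
rewrite Er /= !has_count Ek /=; case: posnP => [E0|gt0] H.
  by exists rs1 => //; rewrite E0; apply: reach_leq H.
have [|rs' E' H'] := IH rs1; first by rewrite E2 Ek subn1.
exists rs'; first by rewrite E'.
have <- : (count (only b c) rs1 < k) = (count (only b c) rs < k.+1).
  by rewrite E3 /=; move: gt0; lia.
exact: reach_trans H H'.
Qed.

(** With all flags clear, either gain is the number of its [only] rows plus that of the rows common
    to both. *)
Lemma only_row_gain (n : nat) (c b : 'I_n) (rs : seq (row n)) :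
  map (@unflag n) rs = rs ->
  (count (only b c) rs < count (only c b) rs) =
  (count (row_gain b) rs < count (row_gain c) rs).
Proof.
move=> Hrs.
suff H (v w : 'I_n) : count (row_gain v) rs =
    count (only v w) rs + count (fun r => row_gain v r && row_gain w r) rs.
  rewrite (H b c) (H c b).
  rewrite -[X in _ + X < _](@eq_count _
    (fun r => row_gain c r && row_gain b r)).
    by rewrite ltn_add2r.
  by move=> r; rewrite andbC.
elim: rs Hrs => //= r rs IH [<- Hrs]; rewrite IH //.
case: r => [[[x p] q] u]; rewrite /row_gain /unsat /=.
by case: q (v \in x) (w \in x) => [] [] [] /=; lia.
Qed.

(** The mark is seen to leave the matrix when it is still carried at the end of a row, which
    requires some row. *)
Lemma round_adv (n : nat) (c b : 'I_n) k (rs : seq (row n)) o :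
  rs != [::] ->
  round (A := greedy_tr) (RAdv k false false, layout c b rs, o) =
  (if c.+1 == n then RPick false else cmp0,
   layout c.+1 (if k then c else b) (map (@unflag n) rs), o).
Proof.
move=> rs_n0; rewrite /round /=.
pose F (t : bool) (r : row n) := (t || (c.+1 == n), unflag r).
rewrite (@sweep_layout n c b c.+1 (if k then c else b) bool (RAdv k false) F);
  last first.
  move=> t [[[x p] q] u].
  apply: (sweep_block (st := fun j => RAdv k (j == c.+1) t)) => /=; last first.
    by rewrite eq_sym.
  by move=> i; rewrite eqSS; case: k.
have -> t : sweep F t rs = (t || (c.+1 == n), map (@unflag n) rs).
  elim: rs rs_n0 t => // r [|r' rs] IH _ t; first by [].
  by rewrite [sweep _ _ _]/= -/(sweep _ _ (r' :: rs)) (IH isT) -orbA orbb.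
by [].
Qed.

Definition pick_row (n : nat) (b : 'I_n) (r : row n) : row n :=
  let: (x, p, q, u) := r in
  if b \in x then (x :\ b, true, p, u) else (x :\ b, p, q, u).

Lemma round_pick (n c : nat) (b : 'I_n) (rs : seq (row n)) o :
  round (A := greedy_tr) (RPick false, layout c b rs, o) =
  (RInit true false, layout c b (map (pick_row b) rs), o).
Proof.
rewrite /round /=.
pose F (t : unit) (r : row n) := (t, pick_row b r).
rewrite (@sweep_layout n c b c b unit (fun=> RPick false) F _ rs tt);
  first by rewrite (sweep_fixed (g := pick_row b)).
  move=> t [[[x p] q] u]; rewrite /F /=.
  have -> : (if b \in x then (x :\ b, true, p, u) else (x :\ b, p, q, u)) =
    (x :\ b, (if b \in x then true else p), (if b \in x then p else q), u).
    by case: ifP.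
  apply: (sweep_block (st := fun j => RPick ((b < j) && (b \in x)))).
    by move=> i /=; rewrite seen_step in_setD1 (andbC (i \in x)).
  by rewrite /= ltn_ord; case: (b \in x).
Qed.

Lemma round_ones (n : nat) (c b : nat) (r : row n) (rs : seq (row n)) o :
  round (A := greedy_tr) (ones0, layout c b (r :: rs), o) =
  (if [pick i : 'I_n | i == c :> nat] is Some i then
     if (i \in r.1.1.1) && (c != b) then ones0 else RNext true false
   else RHalt,
   layout c b.+1 (r :: rs),
   if [pick i : 'I_n | i == c :> nat] is Some i then
     if i \in r.1.1.1 then rcons o s1 else o else o).
Proof.
rewrite /round.
pose emb t := ROnes t.1.1.1 false t.1.1.2 t.1.2 t.2.
pose res (x : {set 'I_n}) := if [pick i : 'I_n | i == c :> nat] is Some i then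
  (false, true, i \in x, c == b) else (false, false, false, false).
pose F (t : bool * bool * bool * bool) (r : row n) :=
  (if t == (true, false, false, false) then res r.1.1.1
   else (false, t.1.1.2, t.1.2, t.2), r).
have -> : tr_stop (ones0 : tr_state greedy_tr) = false by [].
(* The row identity holds only for the initial register and for those past the header, so
   [sweep_layout] does not apply and the rows are treated by a separate induction. *)
have HF t r' : t.1.1.1 = false \/ t = (true, false, false, false) ->
    sweep greedy_step (emb t) (block c b r') =
    (emb (F t r').1, block c b.+1 (F t r').2).
  move: t r' => [[[hd fd] y] e] r' [/= ->|[-> -> -> ->]];
    case: r' => [[[x p] q] u].
    apply: (sweep_block (st := fun j => ROnes false (j == b.+1) fd y e)) => //.
    by move=> i; rewrite /= orbF.
  rewrite /F eqxx /res [(_, _).2]/=; case: pickP => [i /eqP Ei|Hno].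
    apply: (sweep_block (st := fun j => ROnes true (j == b.+1) (c < j)
      ((c < j) && (i \in x)) ((c < j) && (c == b)))).
      move=> j; have -> : (c < j.+1) = (c < j) || (j == c :> nat).
        by rewrite ltnS (leq_eqVlt c) orbC [c == j :> nat]eq_sym.
      rewrite /=; case: (eqVneq (j : nat) c) => [Ej|_]; last by rewrite orbF.
      have -> : i = j by apply: val_inj; rewrite /= Ei Ej.
      by rewrite orbT -Ej.
    by rewrite /= -Ei ltn_ord.
  apply: (sweep_block
    (st := fun j => ROnes true (j == b.+1) false false false)) => //= j.
  by rewrite Hno.
have E0 : sweep greedy_step ones0 (layout c b (r :: rs)) =
   (emb (res r.1.1.1), layout c b.+1 (r :: rs)).
  have -> : ones0 = emb (true, false, false, false) by [].
  rewrite !layout_cons sweep_cat HF; last by right.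
  rewrite [F _ _]/=.
  have {HF}HF (rs' : seq (row n)) t : t.1.1.1 = false ->
     sweep greedy_step (emb t) (layout c b rs') = (emb t, layout c b.+1 rs').
    move=> Ht; have Ft r' : F t r' = (t, r').
      by case: t Ht => [[[hd fd] y] e] /= ->.
    elim: rs' => [|r' rs' IH] //.
    by rewrite !layout_cons sweep_cat HF ?Ft; [rewrite IH | left].
  by rewrite HF /F eqxx //= /res; case: pickP.
rewrite (_ : @tr_step greedy_tr = greedy_step) //.
by rewrite E0 /res; case: pickP => //= i _; case: (i \in _).
Qed.

Lemma round_next (n : nat) (c b : nat) (rs : seq (row n)) o :
  round (A := greedy_tr) (RNext true false, layout c b rs, o) =
  (ones0, layout c.+1 0 rs, rcons o ssep).
Proof.
rewrite /round /=.
pose F (t : unit) (r : row n) := (t, r).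
rewrite (@sweep_layout n c b c.+1 0 unit (fun=> RNext true false) F _ rs tt);
  first by rewrite (sweep_fixed (g := id)) ?map_id.
  move=> t [[[x p] q] u].
exact: (sweep_block (st := fun j => RNext (j == 0) (j == c.+1))).
Qed.

(** * The greedy run *)

Lemma reach_argmax (n : nat) (rs : seq (row n)) o :
  0 < n -> rs != [::] -> map (@unflag n) rs = rs ->
  exists2 b : 'I_n,
    forall j, count (row_gain j) rs <= count (row_gain b) rs &
    reach (@round greedy_tr) (n * (size rs + 2)) (cmp0, layout 0 0 rs, o)
      (RPick false, layout n b rs, o).
Proof.
move=> n_gt0 rs_n0 Hrs.
(* After [k] columns the best mark is optimal among them. A column costs at most [size rs + 1]
   comparing sweeps and one [RAdv] sweep. Column 0 is first compared with itself. *)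
suff H k : k <= n -> exists2 b : 'I_n,
    forall j : 'I_n, j < k -> count (row_gain j) rs <= count (row_gain b) rs &
    reach (@round greedy_tr) (k * (size rs + 2)) (cmp0, layout 0 0 rs, o)
      (if k == n then RPick false else cmp0, layout k b rs, o).
  have [b Hb] := H n (leqnn n); rewrite eqxx => Hr; exists b => // j.
  exact: Hb.
elim: k => [|k IH] le_kn.
  exists (Ordinal n_gt0) => //; rewrite (_ : (0 == n) = false) ?ltn_eqF //.
  exact: reach0.
have [b Hb Hr] := IH (ltnW le_kn); pose c := Ordinal le_kn.
rewrite (ltn_eqF le_kn) in Hr.
have [rs' Ers' Hc] := reach_cmp c b rs o.
rewrite (only_row_gain _ _ Hrs) in Hc.
have rs'_n0 : rs' != [::].
  by rewrite -size_eq0 -(size_map (@unflag n)) Ers' size_map size_eq0.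
have := round_adv c b (count (row_gain b) rs < count (row_gain c) rs) o rs'_n0.
rewrite Ers' Hrs => Ha.
have := reach1 (@round greedy_tr)
  (RAdv (count (row_gain b) rs < count (row_gain c) rs) false false,
   layout c b rs', o).
rewrite Ha => {}Ha.
have {Hr Hc Ha} Hr := reach_trans (reach_trans Hr Hc) Ha.
have le_time : k * (size rs + 2) + (count (only c b) rs).+1 + 1 <=
    k.+1 * (size rs + 2).
  by have := count_size (only c b) rs; rewrite mulSn; lia.
exists (if count (row_gain b) rs < count (row_gain c) rs then c else b).
  move=> j; rewrite ltnS leq_eqVlt => /orP[/eqP Ej|/Hb le_j].
    have -> : j = c by exact: val_inj.
    by case: ltnP.
  by case: ltnP => // /ltnW; apply: leq_trans.
by apply: reach_leq le_time _; move: Hr; case: ifP.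
Qed.

Definition gain (n : nat) (E : seq {set 'I_n}) (S : {set 'I_n}) (v : 'I_n) :
    nat :=
  count (fun e => (#|e :&: S| <= 1) && (v \in e :\: S)) E.

Definition twice_hit (n : nat) (E : seq {set 'I_n}) (S : {set 'I_n}) : bool :=
  all (fun e => 1 < #|e :&: S|) E.

Inductive greedy (n : nat) (E : seq {set 'I_n}) : {set 'I_n} -> Prop :=
  | greedy0 : greedy E set0
  | greedyS S b : greedy E S -> ~~ twice_hit E S ->
      (forall v, gain E S v <= gain E S b) -> greedy E (b |: S).

Definition edge_row (n : nat) (S e : {set 'I_n}) : row n :=
  (e :\: S, 0 < #|e :&: S|, 1 < #|e :&: S|, false).

(** The header row, being satisfied, counts in no gain; its entries record the vertices not yet
    picked, which the output phase reads. *)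
Definition state_rows (n : nat) (E : seq {set 'I_n}) (S : {set 'I_n}) :
    seq (row n) :=
  (~: S, true, true, false) :: [seq edge_row S e | e <- E].

Lemma unflag_state_rows (n : nat) (E : seq {set 'I_n}) S :
  map (@unflag n) (state_rows E S) = state_rows E S.
Proof. by rewrite /state_rows /= -map_comp. Qed.

Lemma count_state_rows (n : nat) (E : seq {set 'I_n}) S v :
  count (row_gain v) (state_rows E S) = gain E S v.
Proof.
rewrite /state_rows /= count_map; apply: eq_count => e.
by rewrite /row_gain /unsat /= -leqNgt.
Qed.

Lemma has_unsat (n : nat) (E : seq {set 'I_n}) S :
  has (@unsat n) (state_rows E S) = ~~ twice_hit E S.
Proof. by rewrite /state_rows /= has_map -has_predC. Qed.

Lemma pick_state_rows (n : nat) (E : seq {set 'I_n}) S b :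
  map (pick_row b) (state_rows E S) = state_rows E (b |: S).
Proof.
rewrite /state_rows /= setCU setIC -map_comp.
have -> : ~: S :\ b = ~: S :&: ~: [set b] by rewrite setDE.
congr (_ :: _); first by case: ifP.
apply: eq_map => e; rewrite /edge_row /= setDDl (setUC S).
rewrite inE (setIUr e).
case: (boolP (b \in S)) => [bS|bNS] /=.
  by rewrite -setIUr (setUidPr (_ : [set b] \subset S)) // sub1set.
case: (boolP (b \in e)) => [be|bNe]; last first.
  by rewrite (setIC e [set b]) (_ : _ :&: e = set0) ?set0U //; apply/setP => i;
    rewrite !inE; case: eqP => // ->; rewrite (negPf bNe).
have -> : e :&: [set b] = [set b] by apply/setIidPr; rewrite sub1set.
by rewrite cardsU1 inE (negPf bNS) andbF add1n.
Qed.

Lemma gain_gt0 (n : nat) (E : seq {set 'I_n}) S :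
  edges_ok E -> ~~ twice_hit E S -> exists v, 0 < gain E S v.
Proof.
move=> /allP Hok /allPn[e eE]; rewrite -leqNgt => le1.
have : 0 < #|e :\: S| by have := cardsID S e; have := Hok _ eE; lia.
case/card_gt0P => v ve; exists v; rewrite -has_count; apply/hasP.
by exists e => //=; rewrite le1.
Qed.

(** Hence a pick of positive gain enlarges the set, which bounds the number of picks by [n]. *)
Lemma gain_notin (n : nat) (E : seq {set 'I_n}) S v :
  0 < gain E S v -> v \notin S.
Proof.
by rewrite -has_count => /hasP[e _ /andP[_]]; rewrite inE => /andP[].
Qed.

Lemma reach_greedy (n : nat) (E : seq {set 'I_n}) c b o :
  edges_ok E ->
  exists S, [/\ greedy E S, twice_hit E S &
    reach (@round greedy_tr) (n.+1 * (n * (size E + 3) + 2))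
      (RInit true false, layout c b (state_rows E set0), o)
      (ones0, layout 0 0 (state_rows E S), o)].
Proof.
move=> Hok.
(* Induction on a bound [k] for the number of unpicked vertices. One pick costs an [RInit] sweep,
   [n * (size E + 3)] sweeps for the maximum and an [RPick] sweep; the marks are arbitrary because
   [RInit] resets them. *)
suff H k S0 c0 b0 : greedy E S0 -> #|~: S0| <= k ->
  exists S, [/\ greedy E S, twice_hit E S &
    reach (@round greedy_tr) (k.+1 * (n * (size E + 3) + 2))
      (RInit true false, layout c0 b0 (state_rows E S0), o)
      (ones0, layout 0 0 (state_rows E S), o)].
  by apply: H; [exact: greedy0 | rewrite setC0 cardsT card_ord].
elim: k S0 c0 b0 => [|k IH] S0 c0 b0 gS0 le_k;
  have := reach1 (@round greedy_tr)
    (RInit true false, layout c0 b0 (state_rows E S0), o);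
  rewrite round_init has_unsat unflag_state_rows;
  case: (boolP (twice_hit E S0)) => [hit|unhit] /= H1.
- by exists S0; split=> //; apply: reach_leq H1; lia.
- have [v /gain_notin vNS] := gain_gt0 Hok unhit.
  have : 0 < #|~: S0| by apply/card_gt0P; exists v; rewrite inE.
  by rewrite lt0n -leqn0 le_k.
- by exists S0; split=> //; apply: reach_leq H1; lia.
have [v gain_v] := gain_gt0 Hok unhit.
have n_gt0 : 0 < n by apply: leq_ltn_trans (ltn_ord v).
have [b1 Hb1 H2] := reach_argmax o n_gt0 (isT : state_rows E S0 != [::])
  (unflag_state_rows E S0).
have := reach1 (@round greedy_tr)
  (RPick false, layout n b1 (state_rows E S0), o).
rewrite round_pick pick_state_rows => H3.
have Hmax w : gain E S0 w <= gain E S0 b1 by rewrite -!count_state_rows.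
have b1NS : b1 \notin S0 by apply: (@gain_notin _ E); apply: leq_trans (Hmax v).
have [||S [gS hS H4]] := IH (b1 |: S0) n b1.
- exact: greedyS.
- have -> : ~: (b1 |: S0) = ~: S0 :\ b1 by rewrite setCU setIC setDE.
  by move: le_k; rewrite (cardsD1 b1 (~: S0)) inE b1NS.
exists S; split=> //.
apply: reach_leq (reach_trans (reach_trans (reach_trans H1 H2) H3) H4).
by rewrite /= size_map; nia.
Qed.

(** * Writing the coloring *)

Definition greedy_cols (n : nat) (S : {set 'I_n}) (s : seq 'I_n) : seq nat :=
  [seq if i \in S then 0 else i.+1 | i <- s].

Lemma enc_col_cat s1 s2 : enc_col (s1 ++ s2) = enc_col s1 ++ enc_col s2.
Proof. by rewrite /enc_col map_cat flatten_cat. Qed.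

Lemma pick_val (n : nat) (c : 'I_n) : [pick i : 'I_n | i == c :> nat] = Some c.
Proof.
by case: pickP => [i /eqP/val_inj -> //|/(_ c)]; rewrite eqxx.
Qed.

(** Each sweep writes one symbol and moves the best mark one column right; the last is the one that
    starts with both marks on [c]. *)
Lemma reach_ones (n : nat) (c : 'I_n) (b : nat) (r : row n) rs o :
  c \in r.1.1.1 -> b <= c ->
  exists b', reach (@round greedy_tr) (c - b).+1
    (ones0, layout c b (r :: rs), o)
    (RNext true false, layout c b' (r :: rs), o ++ nseq (c - b).+1 s1).
Proof.
move=> cr; move Ek : (c - b) => k; elim: k b o Ek => [|k IH] b o Ek le_bc.
  have := reach1 (@round greedy_tr) (ones0, layout c b (r :: rs), o).
  have /eqP Ecb : c == b :> nat by rewrite eqn_leq le_bc andbT -subn_eq0 Ek.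
  rewrite round_ones pick_val cr Ecb eqxx cats1 /= => H.
  by exists b.+1.
have lt_bc : b < c by rewrite -subn_gt0 Ek.
have [||b' H'] := IH b.+1 (rcons o s1); first by rewrite subnS Ek.
  by [].
exists b'; move: H'; rewrite cat_rcons -[k.+2]add1n; apply: reach_trans.
have := reach1 (@round greedy_tr) (ones0, layout c b (r :: rs), o).
by rewrite round_ones pick_val cr eq_sym (ltn_eqF lt_bc).
Qed.

Lemma reach_color (n : nat) (c : 'I_n) (S : {set 'I_n}) p q u rs o :
  reach (@round greedy_tr) (n + 1)
    (ones0, layout c 0 ((~: S, p, q, u) :: rs), o)
    (ones0, layout c.+1 0 ((~: S, p, q, u) :: rs),
     o ++ enc_col (greedy_cols S [:: c])).
Proof.
rewrite /enc_col /= cats0 catA cats1.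
suff [b' H] : exists b', reach (@round greedy_tr) n
    (ones0, layout c 0 ((~: S, p, q, u) :: rs), o)
    (RNext true false, layout c b' ((~: S, p, q, u) :: rs),
     o ++ nseq (if c \in S then 0 else c.+1) s1).
  by apply: reach_trans H _; rewrite -(round_next _ b'); exact: reach1.
case: ifPn => cS; last first.
  have [|//|b' H] := @reach_ones n c 0 (~: S, p, q, u) rs o.
    by rewrite inE.
  by exists b'; move: H; rewrite subn0; apply: reach_leq.
(* A picked vertex has an erased header entry: a single sweep writes no [s1], which encodes color
   0. *)
exists 1; rewrite cats0; apply: (@reach_leq _ _ 1).
  by apply: leq_ltn_trans (ltn_ord c).
have := reach1 (@round greedy_tr)
  (ones0, layout c 0 ((~: S, p, q, u) :: rs), o).
by rewrite round_ones pick_val inE cS.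
Qed.

Lemma reach_output (n : nat) (E : seq {set 'I_n}) S :
  exists w, reach (@round greedy_tr) (n * (n + 1) + 1)
    (ones0, layout 0 0 (state_rows E S), [::])
    (RHalt, w, enc_col (greedy_cols S (enum 'I_n))).
Proof.
have H k : k <= n -> reach (@round greedy_tr) (k * (n + 1))
    (ones0, layout 0 0 (state_rows E S), [::])
    (ones0, layout k 0 (state_rows E S),
     enc_col (greedy_cols S (take k (enum 'I_n)))).
  elim: k => [|k IH] le_kn; first by rewrite take0; exact: reach0.
  pose c := Ordinal le_kn.
  have -> : take k.+1 (enum 'I_n) = rcons (take k (enum 'I_n)) c.
    rewrite (take_nth c) ?size_enum_ord //; congr rcons.
    by apply: val_inj; rewrite /= nth_enum_ord.
  rewrite -cats1 /greedy_cols map_cat enc_col_cat mulSnr.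
  by apply: reach_trans (IH (ltnW le_kn)) _; exact: (@reach_color n c).
have {}H := H n (leqnn n); rewrite take_oversize ?size_enum_ord // in H.
have := reach1 (@round greedy_tr) (ones0, layout n 0 (state_rows E S),
  enc_col (greedy_cols S (enum 'I_n))).
rewrite round_ones; case: pickP => [i /eqP Ei|_ H1].
  by have := ltn_ord i; rewrite Ei ltnn.
by exists (layout n 1 (state_rows E S)); exact: reach_trans H H1.
Qed.

(** The unary prefix with its separator reads as one more row, that of the full set; marks at [n]
    are absent. *)
Lemma load_enc_hg (n : nat) (E : seq {set 'I_n}) :
  map load (enc_hg E) =
  layout n n ((setT, false, false, false) ::
              [seq (e, false, false, false) | e <- E]).
Proof.
have Hoff (i : 'I_n) : (i == n :> nat) = false by exact: ltn_eqF.
have Hb (e : {set 'I_n}) :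
    map load ([seq if i \in e then s1 else s0 | i <- enum 'I_n] ++ [:: ssep]) =
    block n n (e, false, false, false).
  rewrite map_cat -map_comp; congr (_ ++ _).
  by apply: eq_map => i; rewrite /= Hoff; case: ifP.
rewrite layout_cons -Hb /enc_hg -cat1s catA !map_cat; congr (_ ++ _).
  congr (_ ++ _); congr map.
  apply: (@eq_from_nth _ s0); first by rewrite size_nseq size_map size_enum_ord.
  move=> i; rewrite size_nseq => lt_in.
  rewrite nth_nseq lt_in (nth_map (Ordinal lt_in)) ?size_enum_ord //.
  by rewrite inE.
rewrite map_flatten /layout; congr flatten.
by rewrite -!map_comp; apply: eq_map => e /=; rewrite Hb.
Qed.

Lemma reach_all (n : nat) (E : seq {set 'I_n}) :
  edges_ok E ->
  exists S w, [/\ greedy E S, twice_hit E S &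
    reach (@round greedy_tr)
      (1 + n.+1 * (n * (size E + 3) + 2) + (n * (n + 1) + 1))
      (tr_start greedy_tr, map (tr_load greedy_tr) (enc_hg E), [::])
      (RHalt, w, enc_col (greedy_cols S (enum 'I_n)))].
Proof.
move=> Hok; have [S [gS hS H2]] := @reach_greedy n E n n [::] Hok.
have [w H3] := reach_output E S.
exists S, w; split=> //; apply: reach_trans H3; apply: reach_trans H2.
have := reach1 (@round greedy_tr)
  (RStart false, map load (enc_hg E), [::]).
rewrite load_enc_hg round_start /settle /state_rows setC0.
congr (reach _ _ _ (_, layout _ _ (_ :: _), _)).
by apply: eq_map => e; rewrite /edge_row setD0 setI0 cards0.
Qed.

Lemma size_enc_hg (n : nat) (E : seq {set 'I_n}) :
  size (enc_hg E) = (size E).+1 * n.+1.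
Proof.
rewrite /enc_hg size_cat size_nseq /= mulSn addnS; congr (_ + _).+1.
rewrite size_flatten /shape -map_comp.
elim: E => //= e E ->; rewrite size_cat size_map size_enum_ord addn1 mulSn.
by [].
Qed.

(** * Approximation ratio *)

Lemma num_colorsE (n : nat) (T : finType) (phi : 'I_n -> T) :
  num_colors phi = #|[set phi i | i in 'I_n]|.
Proof.
rewrite /num_colors -(card_uniqP (undup_uniq _)); apply: eq_card => c.
rewrite mem_undup; apply/mapP/imsetP => [[i _ ->]|[i _ ->]]; exists i => //.
by rewrite mem_enum.
Qed.

Definition shared (n : nat) (T : finType) (phi : 'I_n -> T) : {set 'I_n} :=
  [set i | [exists j, (j != i) && (phi j == phi i)]].

(** Summed over color classes: a class of size [s >= 2] satisfies [s + 2 <= 2 * s], and a singleton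
    contributes no shared vertex. *)
Lemma card_shared (n : nat) (T : finType) (phi : 'I_n -> T) :
  #|shared phi| <= 2 * (n - num_colors phi).
Proof.
suff: #|shared phi| + 2 * num_colors phi <= 2 * n by lia.
have En : n = \sum_(c in [set phi i | i in 'I_n]) #|[set i | phi i == c]|.
  rewrite -[LHS](card_ord n) -sum1_card (partition_big_imset phi) /=.
  apply: eq_bigr => c _; rewrite -sum1_card; apply: eq_bigl => i.
  by rewrite inE.
have Es : #|shared phi| = \sum_(c in [set phi i | i in 'I_n])
    #|[set i in shared phi | phi i == c]|.
  rewrite -sum1_card (partition_big phi (mem [set phi i | i in 'I_n])) /=.
    apply: eq_bigr => c _; rewrite -sum1_card; apply: eq_bigl => i.
    by rewrite [in RHS]inE.
  by move=> i _; apply: imset_f.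
rewrite [X in _ <= 2 * X]En Es num_colorsE -sum1_card !big_distrr -big_split /=.
apply: leq_sum => c /imsetP[i _ ->]; set K := [set j | phi j == phi i].
have iK : i \in K by rewrite inE.
have subK : [set j in shared phi | phi j == phi i] \subset K.
  by apply/subsetP => j; rewrite !inE => /andP[].
have [gt1|le1] := ltnP 1 #|K|.
  by rewrite muln1 mul2n -addnn leq_add ?subset_leq_card.
have -> : [set j in shared phi | phi j == phi i] = set0.
  apply/setP => j; rewrite !inE; apply/negP.
  move=> /andP[/existsP[k /andP[kj /eqP Ek]] /eqP Ej].
  have /subset_leq_card : [set j; k] \subset K.
    by apply/subsetP => l; rewrite !inE => /orP[]/eqP->; rewrite ?Ek ?Ej.
  by rewrite cards2 eq_sym kj leqNgt ltnS le1.
by rewrite cards0 muln1 add0n leq_pmulr // (cardD1 i) iK.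
Qed.

Lemma shared_twice_hit (n : nat) (E : seq {set 'I_n}) (T : finType)
    (phi : 'I_n -> T) :
  is_Ccoloring E phi -> twice_hit E (shared phi).
Proof.
move=> /allP Hphi; apply/allP => e /Hphi /exists_inP[x xe].
case/exists_inP=> y ye /andP[xy /eqP Exy]; apply/card_gt1P; exists x, y.
split=> //; rewrite !inE ?xe ?ye; apply/existsP; [exists y|exists x];
  by rewrite ?[y == x]eq_sym xy Exy eqxx.
Qed.

Lemma small_twice_hit (n : nat) (E : seq {set 'I_n}) :
  edges_ok E ->
  exists2 T : {set 'I_n}, twice_hit E T & #|T| <= 2 * dec E.
Proof.
(* Without vertices there are no edges. Otherwise the constant coloring is a C-coloring, so the
   maximum in [upper_chi] is attained. *)
case: n E => [|n] E Hok.
  exists set0; last by rewrite cards0.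
  case: E Hok => //= e E /andP[]; have := max_card e.
  by rewrite card_ord leqn0 => /eqP ->.
have const_ok : is_Ccoloring E [ffun=> ord0 : 'I_n.+1].
  apply/allP => e eE; have /card_gt1P[x [y [xe ye xy]]] := allP Hok _ eE.
  by apply/exists_inP; exists x => //; apply/exists_inP; exists y => //;
    rewrite xy !ffunE.
have [|phi Hphi Emax] := @eq_bigmax_cond _
    [pred phi : {ffun 'I_n.+1 -> 'I_n.+1} | is_Ccoloring E phi]
    (fun phi : {ffun 'I_n.+1 -> 'I_n.+1} => num_colors phi).
  by apply/card_gt0P; exists [ffun=> ord0].
exists (shared phi); first exact: shared_twice_hit.
by rewrite /dec /upper_chi Emax card_shared.
Qed.

(** * Decay of the demand along the greedy run *)

Definition demand (n : nat) (E : seq {set 'I_n}) (S : {set 'I_n}) : nat :=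
  \sum_(e <- E) (2 - #|e :&: S|).

Lemma demand_pick (n : nat) (E : seq {set 'I_n}) S b :
  demand E (b |: S) + gain E S b = demand E S.
Proof.
rewrite /demand /gain -sum1_count [X in _ + X]big_mkcond -big_split /=.
apply: eq_bigr => e _; rewrite (setIUr e) inE.
have [bS|bNS] := boolP (b \in S) => /=.
  by rewrite andbF addn0 -setIUr (setUidPr (_ : [set b] \subset S)) ?sub1set.
have [be|bNe] := boolP (b \in e); last first.
  rewrite andbF addn0 (_ : e :&: [set b] = set0) ?set0U //.
  apply/setP => i; rewrite !inE.
  by case: eqP => [->|]; rewrite ?andbF ?(negPf bNe).
have -> : e :&: [set b] = [set b] by apply/setIidPr; rewrite sub1set.
rewrite cardsU1 inE (negPf bNS) andbF.
by case: (#|_|) => [|[|k]].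
Qed.

(** Double counting: [T] meets each edge twice, so an edge hit at most once by [S] has at least
    [2 - #|e :&: S|] vertices in [T] outside [S]. The gains of the vertices of [T] thus add up to at
    least the demand. *)
Lemma demand_leq (n : nat) (E : seq {set 'I_n}) S T g :
  twice_hit E T -> (forall v, gain E S v <= g) -> demand E S <= #|T| * g.
Proof.
move=> /allP HT Hg; apply: (@leq_trans (\sum_(v in T) gain E S v)); last first.
  by rewrite -sum_nat_const; apply: leq_sum.
rewrite /gain; under eq_bigr => v _ do rewrite -sum1_count big_mkcond /=.
rewrite exchange_big /demand /= !big_seq; apply: leq_sum => e /HT two_le.
have [le1|] := leqP #|e :&: S| 1; last by rewrite -subn_eq0 => /eqP ->.
rewrite -big_mkcondr sum1_card /=.
have -> : #|[pred v in T | v \in e :\: S]| = #|(e :&: T) :\: S|.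
  by apply: eq_card => v; rewrite !inE; case: (v \in T); rewrite ?andbF ?andbT.
rewrite leq_subLR; apply: leq_trans two_le _; rewrite -(cardsID S) leq_add2r.
by apply: subset_leq_card; apply: setSI; exact: subsetIl.
Qed.

Lemma demand_gt0 (n : nat) (E : seq {set 'I_n}) S :
  ~~ twice_hit E S -> 0 < demand E S.
Proof.
case/allPn => e eE; rewrite -leqNgt => le1.
by rewrite /demand (big_rem e) //= ltn_addr // subn_gt0.
Qed.

(** With [k = #|T|], a pick of gain [g] turns the demand [D <= k * g] into [D - g], and
    [k * (D - g) <= (k - 1) * D]. Powers of [k] are multiplied out to stay in [nat]. *)
Lemma greedy_demand (n : nat) (E : seq {set 'I_n}) S T :
  twice_hit E T -> greedy E S ->
  demand E S * #|T| ^ #|S| <= 2 * size E * #|T|.-1 ^ #|S|.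
Proof.
move=> HT; elim=> [|{}S b _ IH unhit Hb].
  rewrite cards0 !expn0 !muln1 /demand -sum1_size big_distrr /=.
  by apply: leq_sum => e _; rewrite leq_subr.
have le_D := demand_leq HT Hb; have D_gt0 := demand_gt0 unhit.
have Db := demand_pick E S b.
have gain_b : 0 < gain E S b.
  by move: le_D D_gt0; case: (gain E S b) => //; rewrite muln0; lia.
rewrite cardsU1 (gain_notin gain_b) add1n !expnS !mulnA.
have H1 : demand E (b |: S) * #|T| <= #|T|.-1 * demand E S.
  move: le_D D_gt0; rewrite -Db; case: #|T| => [|k]; first by lia.
  by rewrite mulnDr mulnS /=; move: (demand _ _) (gain _ _ _) => D' g; nia.
apply: (@leq_trans (#|T|.-1 * demand E S * #|T| ^ #|S|)).
  by rewrite leq_mul2r H1 orbT.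
by rewrite -mulnA (mulnAC _ #|T|.-1) [X in _ <= X]mulnC leq_mul2l IH orbT.
Qed.

(** Before the last pick the demand is still at least 1, hence the exponent [#|S|.-1]. *)
Lemma greedy_card (n : nat) (E : seq {set 'I_n}) S T :
  0 < size E -> twice_hit E T -> greedy E S ->
  #|T| ^ #|S|.-1 <= 2 * size E * #|T|.-1 ^ #|S|.-1.
Proof.
move=> E_gt0 HT gS; case: S / gS => [|S b gS unhit Hb].
  by rewrite cards0 /= !expn0 muln1; lia.
have D_gt0 := demand_gt0 unhit.
have bNS : b \notin S.
  apply: (@gain_notin _ E); have := demand_leq HT Hb.
  by move: D_gt0; case: (gain E S b) => //; rewrite muln0; lia.
rewrite cardsU1 bNS /=; apply: leq_trans (greedy_demand HT gS).
exact: leq_pmull.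
Qed.

Lemma INR_expn (a b : nat) : INR (a ^ b) = pow (INR a) b.
Proof. by elim: b => [|b IH] //=; rewrite expnS mult_INR IH. Qed.

(** From [1 - 1/k <= exp (-1/k)] one gets [1 <= c * exp (-s/k)]; then take logarithms. *)
Lemma leq_ln_ratio (k s c : nat) :
  0 < k -> k ^ s <= c * k.-1 ^ s ->
  Rle (INR s) (Rmult (INR k) (ln (INR c))).
Proof.
move=> k_gt0 Hks.
have k0 : Rlt 0 (INR k) by apply: lt_0_INR; apply/ltP.
have Ek : INR k.-1 = Rminus (INR k) 1.
  by rewrite -{2}(prednK k_gt0) S_INR; lra.
have c_gt0 : 0 < c.
  by case: c Hks => //; rewrite mul0n leqn0 expn_eq0 (gtn_eqF k_gt0).
have c0 : Rlt 0 (INR c) by apply: lt_0_INR; apply/ltP.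
have Hexp : Rle (INR k.-1) (Rmult (INR k) (exp (Ropp (Rinv (INR k))))).
  have := exp_ineq1_le (Ropp (Rinv (INR k))).
  move/(Rmult_le_compat_l (INR k) _ _ (Rlt_le _ _ k0)).
  by rewrite Rmult_plus_distr_l Ek Ropp_mult_distr_r_reverse Rinv_r; lra.
have {Hks} : Rle (INR (k ^ s)) (INR (c * k.-1 ^ s)) by apply: le_INR; apply/leP.
rewrite mult_INR !INR_expn => Hks.
have Hpow : Rle (pow (INR k.-1) s)
    (Rmult (pow (INR k) s) (exp (Ropp (Rmult (INR s) (Rinv (INR k)))))).
  apply: Rle_trans (pow_incr _ _ s (conj (pos_INR _) Hexp)) _.
  rewrite Rpow_mult_distr; apply: Req_le; congr Rmult.
  elim: (s) => [|j IH]; first by rewrite Rmult_0_l Ropp_0 exp_0.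
  rewrite S_INR [pow _ _]/= IH -exp_plus; congr exp; ring.
have ks0 : Rlt 0 (pow (INR k) s) by exact: pow_lt.
set z := Rmult (INR s) (Rinv (INR k)) in Hpow.
have : Rle 1 (Rmult (INR c) (exp (Ropp z))).
  apply: (Rmult_le_reg_l _ _ _ ks0).
  have := Rmult_le_compat_l _ _ _ (Rlt_le _ _ c0) Hpow; nra.
rewrite exp_Ropp => Hz.
have {Hz} : Rle (exp z) (INR c).
  have ez := exp_pos z.
  have := Rmult_le_compat_l _ _ _ (Rlt_le _ _ ez) Hz.
  rewrite (Rmult_comm (exp z) (Rmult _ _)) Rmult_assoc Rinv_l; lra.
(* [ln_increasing] is strict, so the case [exp z = INR c] is treated apart. *)
case/Rle_lt_or_eq_dec => [/(ln_increasing _ _ (exp_pos z))|<-]; rewrite ln_exp.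
  move=> /Rlt_le/(Rmult_le_compat_l _ _ _ (Rlt_le _ _ k0)).
  by rewrite /z (Rmult_comm (INR s)) -Rmult_assoc Rinv_r ?Rmult_1_l; lra.
by rewrite /z (Rmult_comm (INR s)) -Rmult_assoc Rinv_r ?Rmult_1_l; lra.
Qed.

Lemma nth_greedy_cols (n : nat) (S : {set 'I_n}) (i : 'I_n) :
  nth 0 (greedy_cols S (enum 'I_n)) i = if i \in S then 0 else i.+1.
Proof. by rewrite (nth_map i) ?size_enum_ord // nth_ord_enum. Qed.

Lemma greedy_cols_coloring (n : nat) (E : seq {set 'I_n}) (S : {set 'I_n}) :
  twice_hit E S ->
  is_Ccoloring E (fun i : 'I_n => nth 0 (greedy_cols S (enum 'I_n)) i).
Proof.
move=> /allP HS; apply/allP => e /HS /card_gt1P[x [y []]].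
rewrite !inE => /andP[xe xS] /andP[ye yS] xy.
apply/exists_inP; exists x => //; apply/exists_inP; exists y => //.
by rewrite xy !nth_greedy_cols xS yS.
Qed.

Lemma greedy_cols_decrement (n : nat) (S : {set 'I_n}) :
  n - num_colors (fun i : 'I_n => nth 0 (greedy_cols S (enum 'I_n)) i) <=
  #|S|.-1.
Proof.
set phi := fun i : 'I_n => _.
pose l := [seq (i : 'I_n).+1 | i <- enum (~: S)].
have Ul : uniq l by rewrite map_inj_uniq ?enum_uniq // => i j [/val_inj].
have sub_l : {subset l <= undup [seq phi i | i <- enum 'I_n]}.
  move=> c /mapP[i]; rewrite mem_enum inE => iS ->.
  rewrite mem_undup; apply/mapP; exists i; first by rewrite mem_enum.
  by rewrite /phi nth_greedy_cols (negPf iS).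
have size_l : size l = n - #|S|.
  by rewrite size_map -cardE -[X in X - _](card_ord n) -(cardsC S) addKn.
have le_S : #|S| <= n by have := max_card S; rewrite card_ord.
(* For empty [S] the bound [0.-1] is 0 and all [n] colors occur; otherwise color 0 joins the
   [n - #|S|] positive ones. *)
have [S0|[i iS]] := set_0Vmem S.
  have := uniq_leq_size Ul sub_l.
  by rewrite size_l S0 cards0 subn0 -subn_eq0 => /eqP ->.
have Ul0 : uniq (0 :: l) by rewrite /= Ul andbT; apply/mapP => -[].
have /(uniq_leq_size Ul0) :
    {subset 0 :: l <= undup [seq phi i | i <- enum 'I_n]}.
  move=> c; rewrite inE => /orP[/eqP ->|/sub_l //].
  rewrite mem_undup; apply/mapP; exists i; first by rewrite mem_enum.
  by rewrite /phi nth_greedy_cols iS.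
rewrite -/(num_colors phi) /= size_l.
have : 0 < #|S| by [apply/card_gt0P; exists i]; move: le_S.
by case: #|S| => [|k]; move: (num_colors phi) => N; lia.
Qed.

Theorem theorem2 :
  exists (M : TM) (c d : nat),
  forall (n : nat) (E : seq {set 'I_n}),
    edges_ok E ->
    exists (t : nat) (cols : seq nat),
      [/\ t <= c * (size (enc_hg E)) ^ d + c,
          halts_with M (enc_hg E) t (enc_col cols),
          size cols = n,
          is_Ccoloring E (fun i : 'I_n => nth 0 cols i)
        & Rle (INR (n - num_colors (fun i : 'I_n => nth 0 cols i)))
              (Rmult (Rplus (INR 2) (Rmult (INR 2) (ln (Rmult (INR 2) (INR (size E))))))
                     (INR (dec E)))].
Proof.
(* With [Q = N ^ 2 >= 1] and [K <= 8 * Q], the time is at most [(8 * Q + 2) * (18 * Q + 3) <= 10 * Q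
   * (21 * Q) = 210 * N ^ 4]. *)
exists (sim greedy_tr), 210, 4 => n E Hok.
have [S [w [gS hS Hr]]] := reach_all Hok.
have N_gt0 : 0 < size (enc_hg E) by rewrite size_enc_hg.
have [t le_t Ht] := transducer_sim N_gt0 Hr isT.
exists t, (greedy_cols S (enum 'I_n)); split=> //.
- apply: leq_trans le_t _; rewrite size_enc_hg.
  set K := 1 + _ + _; set N := (size E).+1 * n.+1.
  have N_ge1 : 1 <= N by [].
  have leK : K <= 8 * (N * N) by rewrite /K /N; nia.
  have leN : N <= N * N by rewrite leq_pmulr.
  rewrite (_ : N ^ 4 = N * N * (N * N)).
    2: by rewrite !expnS expn0 muln1 !mulnA.
  move: (N * N) leK leN => Q leK leN; nia.
- by rewrite size_map size_enum_ord.
- exact: greedy_cols_coloring.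
have le_dec := greedy_cols_decrement S.
set D := n - _ in le_dec *.
have INR2 : INR 2 = IZR 2 by rewrite /=; lra.
have dec0 := pos_INR (dec E).
(* Without edges the greedy set is empty and the decrement is 0; [ln 0] is 0 by convention, so the
   right-hand side is nonnegative. *)
case: (posnP (size E)) => [E0|E_gt0].
  have -> : D = 0.
    case: gS le_dec => [|S' b _]; last by rewrite /twice_hit (size0nil E0).
    by rewrite cards0 leqn0 => /eqP.
  rewrite E0 !INR_0 Rmult_0_r {1}/ln.
  case: Rlt_dec => [lt00|_]; first by have := Rlt_irrefl _ lt00.
  by rewrite INR2; nra.
have [T hT le_T] := small_twice_hit Hok.
have T_gt0 : 0 < #|T|.
  case: (E) E_gt0 hT => //= e E' _ /andP[/ltnW]; rewrite !card_gt0.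
  by move=> /set0Pn[x /setIP[_ xT]] _; apply/set0Pn; exists x.
have := leq_ln_ratio T_gt0 (greedy_card E_gt0 hT gS).
rewrite mult_INR; set L := ln _ => Hs.
(* Nonnegativity of [ln (2m)] is the case [k = 1], [s = 0] of [leq_ln_ratio]. *)
have L0 : Rle 0 L.
  have /(@leq_ln_ratio 1 0 _ isT) : 1 ^ 0 <= 2 * size E * 1.-1 ^ 0.
    by rewrite !expn0 muln1 muln_gt0.
  by rewrite mult_INR -/L Rmult_1_l.
have HD : Rle (INR D) (INR #|S|.-1) by apply: le_INR; apply/leP.
have HT : Rle (INR #|T|) (Rmult (INR 2) (INR (dec E))).
  by rewrite -mult_INR; apply: le_INR; apply/leP.
(* The chain is [D <= #|S|.-1 <= #|T| * L <= 2 * dec E * L], to which the nonnegative [2 * dec E] is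
   added. *)
have := Rmult_le_compat_r _ _ _ L0 HT; rewrite INR2; nra.
Qed.
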